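(* Let $C_1,\ldots,C_l$ be $mn\times mn$ $(0,1)$-matrices such that (i) $\sum_{a=1}^lC_a=kI_{mn}+\lambda_1(I_m\otimes J_n-I_{mn})+\lambda_2(J_{mn}-I_m\otimes J_n)$; (ii) $C_aC_a^\top=\alpha C_a$ for every $a$, for some real $\alpha$; (iii) $C_aC_b^\top=\beta J_{mn}$ for all distinct $a,b$, for some real $\beta$. Assume that either $\alpha\lambda_1\neq\alpha\lambda_2=\beta l$, or $\alpha\lambda_1=\alpha\lambda_2\neq\beta l$; put $(m^*,n^* )=(lm,n)$ in the first case and $(m^*,n^* )=(l,mn)$ in the second. Then: (1) if there exists a Latin square on $\{1,\ldots,l\}$, then there exists a symmetric group divisible design with parameters $(lmn,\alpha k,m^*,n^*,\alpha\lambda_1,l\beta)$; (2) if there exist linked UFS Latin squares $L_{i,j}$ ($i,j\in\{1,\ldots,f\}$, $i\neq j$) on $\{1,\ldots,l\}$, then there exists a linked system of symmetric group divisible designs (indexed by $\{1,\ldots,f\}$) with parameters $(lmn,\alpha k,m^*,n^*,\alpha\lambda_1,l\beta)$ and constants $(\sigma,\tau)=(\alpha+(l-1)\beta,(l-1)\beta)$.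
   Context: $I_n,J_n$ denote the identity and all-ones matrices of order $n$; $\otimes$ is the Kronecker product. A $v\times v$ $(0,1)$-matrix $A$ ($v=m'n'$) is the incidence matrix of a symmetric group divisible design with parameters $(v,k',m',n',\mu_1,\mu_2)$ if $AA^\top=A^\top A=k'I_v+\mu_1(I_{m'}\otimes J_{n'}-I_v)+\mu_2(J_v-I_{m'}\otimes J_{n'})$. A linked system of such designs with constants $\sigma,\tau$ is a family of such incidence matrices $A_{i,j}$ ($i\neq j$ in $\{1,\ldots,f\}$) with $A_{i,j}^\top=A_{j,i}$ and $A_{i,j}A_{j,l}=\sigma A_{i,l}+\tau(J_v-A_{i,l})$ for all pairwise distinct $i,j,l$. Two Latin squares $L,L'$ of order $l$ on $\{1,\ldots,l\}$ are UFS if for every row $i$ of $L$ and every row $j$ of $L'$ there is exactly one column $a$ with $L(i,a)=L'(j,a)$; in that case the square obtained from $L$ and $L'$ (in this order) is the $l\times l$ array whose $(i,j)$-entry is $L(i,a)=L'(j,a)$ for this unique $a$ (it is a Latin square). For $f\ge3$, Latin squares $L_{i,j}$ ($i\ne j$ in $\{1,\ldots,f\}$) on the same symbol set are linked UFS Latin squares if for all pairwise distinct $i,j,k$, $L_{i,k}$ and $L_{j,k}$ are UFS and the square obtained from $L_{i,k}$ and $L_{j,k}$ (in this order) equals $L_{i,j}$. *)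

(* Defs.v *)
From mathcomp Require Import all_boot all_order all_algebra.
From mathcomp Require Import reals mxtens.

Set Implicit Arguments.
Unset Strict Implicit.
Unset Printing Implicit Defensive.

Import Order.TTheory GRing.Theory Num.Theory.
Local Open Scope ring_scope.

Section Designs.
Variable R : realType.

Definition allones (v : nat) : 'M[R]_v := const_mx 1.

(* [I_m (x) J_n], with [*t] the Kronecker product of [mxtens]: point [x] lies
   in group [x %/ n]. *)
Definition group_mx (m n : nat) : 'M[R]_(m * n) := 1%:M *t allones n.

Definition zero_one_mx (v : nat) (A : 'M[R]_v) : Prop :=
  forall i j, A i j = 0 \/ A i j = 1.

(* The right-hand side [k I + mu1 (I_m (x) J_n - I) + mu2 (J - I_m (x) J_n)]. *)
Definition gd_mx (m n : nat) (k mu1 mu2 : R) : 'M[R]_(m * n) :=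
  k%:M + mu1 *: (group_mx m n - 1%:M)
       + mu2 *: (allones (m * n) - group_mx m n).

(* The cast only transports [gd_mx] along [v = m * n]; equality proofs in [nat]
   being unique, the choice of [e] is irrelevant. *)
Definition sgdd_incidence (v : nat) (k : R) (m n : nat) (mu1 mu2 : R)
    (A : 'M[R]_v) : Prop :=
  zero_one_mx A /\
  exists e : (m * n)%N = v,
    A *m A^T = castmx (e, e) (gd_mx m n k mu1 mu2) /\
    A^T *m A = castmx (e, e) (gd_mx m n k mu1 mu2).

(* A family indexed by the ordered pairs of distinct elements of [{1,...,f}] is
   a function of two arguments whose diagonal values are unconstrained; the same
   convention is used for [linked_ufs] below. *)
Definition linked_sgdd (f v : nat) (k : R) (m n : nat) (mu1 mu2 : R)
    (sigma tau : R) (A : 'I_f -> 'I_f -> 'M[R]_v) : Prop :=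
  [/\ forall i j, i != j -> sgdd_incidence k m n mu1 mu2 (A i j),
      forall i j, i != j -> (A i j)^T = A j i
    & forall i j h, i != j -> j != h -> i != h ->
        A i j *m A j h = sigma *: A i h + tau *: (allones v - A i h)].

End Designs.

Section LatinSquares.
Variable l : nat.
Implicit Types L M : 'M['I_l]_l.

Definition latin_square L : Prop :=
  (forall i s, exists! j, L i j = s) /\ (forall j s, exists! i, L i j = s).

Definition ufs L L' : Prop :=
  [/\ latin_square L, latin_square L'
    & forall i j, exists! a, L i a = L' j a].

(* [M] is the square obtained from [L] and [L'], in this order. *)
Definition ufs_square L L' M : Prop :=
  ufs L L' /\ forall i j a, L i a = L' j a -> M i j = L i a.

Definition linked_ufs (f : nat) (L : 'I_f -> 'I_f -> 'M['I_l]_l) : Prop :=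
  [/\ (3 <= f)%N,
      forall i j, i != j -> latin_square (L i j)
    & forall i j h, i != j -> j != h -> i != h ->
        ufs_square (L i h) (L j h) (L i j)].

End LatinSquares.

(* Main.v *)
(** Substituting [C_a] for each symbol [a] of a Latin square [L] gives the
    block matrix [A = (C_(L i j))].  By (ii) every [C_a] is symmetric, so a block
    of a product of two such matrices is [\sum_a C_(g a) C_(h a)], where [g] and
    [h] are a row of the first square and a column of the second: agreements of
    [g] and [h] contribute [alpha C_(g a)], disagreements [beta J].  Two lines
    of a Latin square agree everywhere or nowhere, which gives (1); two lines of
    a UFS pair agree exactly once, which gives (2). *)
Require Import Defs.
From mathcomp Require Import all_boot all_order all_algebra.
From mathcomp Require Import reals mxtens ring.

Set Implicit Arguments.
Unset Strict Implicit.
Unset Printing Implicit Defensive.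

Import Order.TTheory GRing.Theory Num.Theory.
Local Open Scope ring_scope.

Section Blocks.
Variables (R : realType) (p q : nat).
Implicit Types F G : 'I_p -> 'I_p -> 'M[R]_q.

(** Splitting indices by [mxtens_unindex], as [*t] does, makes [x %/ q] the block and [x %% q] the
    offset, so blocks and groups are compared by plain division. *)
Definition blocks F : 'M[R]_(p * q) :=
  \matrix_(x, y) F (mxtens_unindex x).1 (mxtens_unindex y).1
                   (mxtens_unindex x).2 (mxtens_unindex y).2.

Lemma eq_blocks F G : (forall i j, F i j = G i j) -> blocks F = blocks G.
Proof. by move=> eqFG; apply/matrixP => x y; rewrite !mxE eqFG. Qed.

Lemma tr_blocks F : (blocks F)^T = blocks (fun i j => (F j i)^T).
Proof. by apply/matrixP => x y; rewrite !mxE. Qed.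

Lemma mul_blocks F G :
  blocks F *m blocks G = blocks (fun i j => \sum_c F i c *m G c j).
Proof.
apply/matrixP => x y; rewrite !mxE summxE.
under [RHS]eq_bigr do rewrite mxE.
rewrite pair_big (reindex (@mxtens_index p q)) /=; last first.
  by exists (@mxtens_unindex p q) => z _; rewrite ?mxtens_indexK ?mxtens_unindexK.
by apply: eq_bigr => -[c z] _; rewrite !mxE mxtens_indexK.
Qed.

Lemma blocks01 F :
  (forall i j, zero_one_mx (F i j)) -> zero_one_mx (blocks F).
Proof. by move=> F01 x y; rewrite mxE; apply: F01. Qed.

End Blocks.

Section GroupDivisible.
Variable R : realType.

Lemma gd_mxE m n (k mu1 mu2 : R) (x y : 'I_(m * n)) :
  gd_mx m n k mu1 mu2 x y =
    k * (x == y)%:R + mu1 * ((x %/ n == y %/ n)%N%:R - (x == y)%:R)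
    + mu2 * (1 - (x %/ n == y %/ n)%N%:R).
Proof. by rewrite !mxE -val_eqE /= !mulr1 mulr_natr. Qed.

Lemma eq_divmod p q (x y : 'I_(p * q)) :
  (x == y) = (x %/ q == y %/ q)%N && (x %% q == y %% q)%N.
Proof.
by rewrite -(inj_eq (can_inj (@mxtens_unindexK p q))) -pair_eqE.
Qed.

(** Off-diagonal blocks repeat the constant [mu2] that already separates distinct groups inside a
    block, so the groups of the [l] blocks simply become the groups of the whole. *)
Lemma blocks_gd_mx_refined l m n (k mu1 mu2 : R)
    (e : (l * m * n = l * (m * n))%N) :
  blocks (fun i j : 'I_l =>
    if i == j then gd_mx m n k mu1 mu2 else mu2 *: allones R (m * n)) =
  castmx (e, e) (gd_mx (l * m) n k mu1 mu2).
Proof.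
(* [z %/ n] numbers the group of [z] among all [l * m]; its quotient by [m] is the block, its
   remainder the group inside that block. *)
have div_blk (z : nat) : (z %/ (m * n) = z %/ n %/ m)%N by rewrite mulnC divnMA.
have div_in (z : nat) : (z %% (m * n) %/ n = z %/ n %% m)%N by rewrite modn_divl.
apply/matrixP => x y; rewrite castmxE gd_mxE mxE.
rewrite -![_ == _ :> 'I_ _]val_eqE /= [val x == val y]val_eqE.
case: ifP => [exy|nexy].
  rewrite gd_mxE -[Ordinal _ == _]val_eqE /= !div_in (eq_divmod x y) exy /=.
  move: exy; rewrite !div_blk => /eqP exy.
  suff -> : (x %/ n == y %/ n)%N = (x %/ n %% m == y %/ n %% m)%N by [].
  by rewrite {1}(divn_eq (x %/ n) m) {1}(divn_eq (y %/ n) m) exy eqn_add2l.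
have nd : (x %/ n == y %/ n)%N = false.
  by apply: contraFF nexy => /eqP exy; rewrite !div_blk exy.
by rewrite (eq_divmod x y) nexy nd !mxE /=; ring.
Qed.

(** A diagonal block with one constant off its own diagonal is a single group. *)
Lemma blocks_gd_mx_coarse l q (k mu1 mu2 : R) :
  blocks (fun i j : 'I_l =>
    if i == j then k%:M + mu1 *: (allones R q - 1%:M)
    else mu2 *: allones R q) = gd_mx l q k mu1 mu2.
Proof.
apply/matrixP => x y; rewrite gd_mxE mxE -[_ == _ :> 'I_l]val_eqE.
rewrite (eq_divmod x y) /=.
case: ifP => _ /=; rewrite !mxE; last by ring.
by rewrite -val_eqE /=; case: (_ == _); rewrite ?mulr1n ?mulr0n; ring.
Qed.

Lemma gd_mx_const m n (k mu : R) :
  gd_mx m n k mu mu = k%:M + mu *: (allones R (m * n) - 1%:M).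
Proof.
by rewrite /gd_mx -addrA -scalerDr [_ - 1%:M + _]addrC addrA subrK.
Qed.

End GroupDivisible.

Lemma mulmx_tr_eq0 (R : realType) p q (A : 'M[R]_(p, q)) :
  A *m A^T = 0 -> A = 0.
Proof.
move=> AA0; apply/matrixP => i j; rewrite [RHS]mxE.
have := congr1 (fun B : 'M_p => B i i) AA0; rewrite !mxE => s0.
have ge0 z (_ : true) : 0 <= A i z * A^T z i by rewrite mxE sqr_ge0.
by have /eqP := psumr_eq0P ge0 s0 (i := j) isT; rewrite mxE mulf_eq0 orbb => /eqP.
Qed.

(** The Gram matrix is symmetric, and [c] cancels if nonzero; for [c = 0] the rows of [A] have zero
    sums of squares, so [A] vanishes. *)
Lemma scaled_gram_sym (R : realType) p (A : 'M[R]_p) (c : R) :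
  A *m A^T = c *: A -> A^T = A.
Proof.
have [->|c0] := eqVneq c 0.
  by rewrite scale0r => /mulmx_tr_eq0 ->; rewrite trmx0.
move=> AA; have : (A *m A^T)^T = A *m A^T by rewrite trmx_mul trmxK.
by rewrite AA linearZ => /(scalerI c0).
Qed.

Lemma latin_tr l (L : 'M['I_l]_l) : latin_square L -> latin_square L^T.
Proof.
case=> rL cL; split=> i s.
  by have [j [Lj Uj]] := cL i s; exists j; split=> [|j']; rewrite mxE // => /Uj.
by have [j [Lj Uj]] := rL i s; exists j; split=> [|j']; rewrite mxE // => /Uj.
Qed.

Section Substitution.
Variables (R : realType) (l q : nat) (alpha beta : R) (C : 'I_l -> 'M[R]_q).
Hypothesis hdiag : forall a, C a *m (C a)^T = alpha *: C a.
Hypothesis hoff :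
  forall a b, a != b -> C a *m (C b)^T = beta *: allones R q.
Implicit Types L M : 'M['I_l]_l.

Lemma family_sym a : (C a)^T = C a.
Proof. exact: scaled_gram_sym (hdiag a). Qed.

Lemma family_mul a b :
  C a *m C b = if a == b then alpha *: C a else beta *: allones R q.
Proof.
by rewrite -(family_sym b); case: eqP => [<-|/eqP/hoff//]; apply: hdiag.
Qed.

Definition subst_mx (L : 'M['I_l]_l) : 'M[R]_(l * q) :=
  blocks (fun i j => C (L i j)).

Lemma tr_subst_mx L : (subst_mx L)^T = subst_mx L^T.
Proof.
by rewrite tr_blocks; apply: eq_blocks => i j; rewrite family_sym mxE.
Qed.

Lemma sum_no_agreement (g h : 'I_l -> 'I_l) :
  (forall a, g a != h a) ->
  \sum_a C (g a) *m C (h a) = (l%:R * beta) *: allones R q.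
Proof.
move=> ne; under eq_bigr do rewrite family_mul (negbTE (ne _)).
by rewrite sumr_const card_ord mulr_natl -scaler_nat scalerA mulr_natl.
Qed.

Lemma sum_one_agreement (g h : 'I_l -> 'I_l) (x : 'I_l) :
  (forall a, (g a == h a) = (a == x)) ->
  \sum_a C (g a) *m C (h a)
    = alpha *: C (g x) + ((l%:R - 1) * beta) *: allones R q.
Proof.
move=> agr; rewrite (bigD1 x) //= family_mul agr eqxx; congr (_ + _).
under eq_bigr => a ax do rewrite family_mul agr (negbTE ax).
rewrite sumr_const cardC1 card_ord -scaler_nat scalerA.
(* The count [l.-1] casts to [l%:R - 1] because [x : 'I_l] forces [0 < l]. *)
by rewrite -subn1 natrB // (leq_trans _ (ltn_ord x)).
Qed.

Lemma subst_mx_gram L : latin_square L ->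
  subst_mx L *m (subst_mx L)^T =
  blocks (fun i j => if i == j then alpha *: \sum_a C a
                     else (l%:R * beta) *: allones R q).
Proof.
case=> rL cL; rewrite tr_subst_mx mul_blocks; apply: eq_blocks => i j.
case: eqP => [<-|/eqP nij].
  (* A row is a permutation of the symbols, so summing along it gives the sum of all [C a]. *)
  have inj_row : injective (L i).
    move=> a b eab.
    by have [c [_ U]] := rL i (L i b); rewrite -(U a eab) -(U b erefl).
  rewrite scaler_sumr [RHS](reindex_inj inj_row) /=.
  by apply: eq_bigr => a _; rewrite mxE family_mul eqxx.
under eq_bigr do rewrite mxE.
apply: sum_no_agreement => a; apply: contra nij => /eqP eij.
by have [c [_ U]] := cL a (L j a); rewrite -(U i eij) -(U j erefl).
Qed.

(** Transposing [L'] makes block [(i, j)] compare row [i] of [L] with row [j] of [L']; their one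
    common symbol is [M i j]. *)
Lemma subst_mx_linked L L' M : ufs_square L L' M ->
  subst_mx L *m subst_mx L'^T =
  (alpha + (l%:R - 1) * beta) *: subst_mx M
  + ((l%:R - 1) * beta) *: (allones R (l * q) - subst_mx M).
Proof.
case=> -[_ _ U] hM; rewrite mul_blocks; apply/matrixP => x y; rewrite !mxE.
set i := (mxtens_unindex x).1; set j := (mxtens_unindex y).1.
have [a [La Ua]] := U i j.
under eq_bigr do rewrite mxE.
rewrite (sum_one_agreement (x := a)); first by rewrite -(hM i j a La) !mxE; ring.
by move=> b; apply/eqP/eqP => [/Ua|->].
Qed.

End Substitution.

(** For a third index [h], supplied by [3 <= f], both [L i j] at [(c, r)] and [L j i] at [(r, c)]
    are the common symbol of row [c] of [L i h] and row [r] of [L j h]. *)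
Lemma linked_ufs_tr l f (L : 'I_f -> 'I_f -> 'M['I_l]_l) i j :
  linked_ufs L -> i != j -> (L i j)^T = L j i.
Proof.
case=> f3 _ hL nij.
have [h hij] : exists h, h \notin [set i; j].
  apply/existsP; rewrite -negb_forall; apply/negP => /forallP all_ij.
  have : (#|'I_f| <= #|[set i; j]|)%N.
    by apply/subset_leq_card/subsetP => x _; have := all_ij x.
  by rewrite card_ord cards2 nij leqNgt f3.
move: hij; rewrite !inE negb_or => /andP[hi hj].
have [ih jh ji] : [/\ i != h, j != h & j != i] by rewrite ![_ == h]eq_sym [j == i]eq_sym.
have [[_ _ U] M1] := hL i j h nij jh ih.
have [_ M2] := hL j i h ji ih jh.
apply/matrixP => r c; rewrite mxE.
by have [a [La _]] := U c r; rewrite (M1 _ _ _ La) (M2 _ _ _ (esym La)).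
Qed.

Theorem theorem5p6 (R : realType) (m n l : nat)
    (k lambda1 lambda2 alpha beta : R) (C : 'I_l -> 'M[R]_(m * n))
    (mstar nstar : nat)
    (C01 : forall a, zero_one_mx (C a))
    (hsum : \sum_(a < l) C a =
       k%:M + lambda1 *: (1%:M *t allones R n - 1%:M)
            + lambda2 *: (allones R (m * n) - 1%:M *t allones R n))
    (hdiag : forall a, C a *m (C a)^T = alpha *: C a)
    (hoff : forall a b, a != b -> C a *m (C b)^T = beta *: allones R (m * n))
    (hcases :
       [/\ alpha * lambda1 <> alpha * lambda2,
           alpha * lambda2 = beta * l%:R
         & (mstar = l * m)%N /\ nstar = n]
       \/
       [/\ alpha * lambda1 = alpha * lambda2,
           alpha * lambda2 <> beta * l%:R
         & mstar = l /\ (nstar = m * n)%N]) :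
  ((exists L : 'M['I_l]_l, latin_square L) ->
     exists A : 'M[R]_(l * m * n),
       sgdd_incidence (alpha * k) mstar nstar
         (alpha * lambda1) (l%:R * beta) A)
  /\
  (forall (f : nat) (L : 'I_f -> 'I_f -> 'M['I_l]_l), linked_ufs L ->
     exists A : 'I_f -> 'I_f -> 'M[R]_(l * m * n),
       linked_sgdd (alpha * k) mstar nstar
         (alpha * lambda1) (l%:R * beta)
         (alpha + (l%:R - 1) * beta) ((l%:R - 1) * beta) A).
Proof.
have hblocks : exists e : (mstar * nstar = l * (m * n))%N,
    blocks (fun i j : 'I_l => if i == j then alpha *: \sum_a C a
                              else (l%:R * beta) *: allones R (m * n)) =
    castmx (e, e) (gd_mx mstar nstar (alpha * k) (alpha * lambda1) (l%:R * beta)).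
  have scale_sum : alpha *: \sum_a C a =
      gd_mx m n (alpha * k) (alpha * lambda1) (alpha * lambda2).
    by rewrite hsum 2!scalerDr scale_scalar_mx !scalerA.
  rewrite scale_sum [l%:R * beta]mulrC.
  case: hcases => -[h1 h2 [-> ->]].
    rewrite h2; exists (esym (mulnA l m n)); exact: blocks_gd_mx_refined.
  exists erefl; rewrite castmx_id -h1 gd_mx_const.
  exact: blocks_gd_mx_coarse.
have subst_sgdd L : latin_square L ->
    sgdd_incidence (alpha * k) mstar nstar (alpha * lambda1) (l%:R * beta)
      (subst_mx C L).
  move=> latL; split; first by apply: blocks01 => i j.
  have [e he] := hblocks; exists e; rewrite -he.
  split; first exact: subst_mx_gram latL.
  (* The product in the other order is the Gram matrix for the transposed square, whose block form
     is the same. *)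
  rewrite -(subst_mx_gram hdiag hoff (latin_tr latL)).
  by rewrite (tr_subst_mx hdiag) (tr_subst_mx hdiag) trmxK.
(* Reassociating the order to [l * (m * n)] lets the block matrices serve as witnesses without a
   cast. *)
rewrite -mulnA; split=> [[L latL]|f L lkL].
  by exists (subst_mx C L); apply: subst_sgdd.
exists (fun i j => subst_mx C (L i j)); have [_ latL hL] := lkL.
split=> [i j nij|i j nij|i j h nij njh nih].
- exact/subst_sgdd/latL.
- by rewrite (tr_subst_mx hdiag) (linked_ufs_tr lkL).
have nhj : h != j by rewrite eq_sym.
(* Written as the transpose of [L h j], the second factor forms with [L i j] the UFS pair whose
   square is [L i h]. *)
by rewrite -(linked_ufs_tr lkL nhj); apply/(subst_mx_linked hdiag hoff)/hL.
Qed.
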